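(* Let $f$ be a homogeneous polynomial of degree $4$ on $\mathbb{R}^n$ satisfying $|\nabla_x f|^2=16|x|^6$. Then either $f$ is isoparametric, or $f$ is congruent to $(\sum_{i=1}^n x_i^2)^2-8(\sum_{i=1}^k x_i^2)(\sum_{i=k+1}^n x_i^2)$ for some $k\in\{0,1,\ldots,[n/2]\}$.
   Context: A homogeneous polynomial $f$ of degree $g$ on $\mathbb{R}^n$ is called eikonal if $|\nabla_x f|^2=g^2|x|^{2g-2}$. It is called isoparametric if, in addition, $\Delta_x f=\frac{m_2-m_1}{2}g^2|x|^{g-2}$ for some integers $m_1,m_2$ (the Münzner–Cartan equations; equivalently its level sets in the unit sphere are isoparametric hypersurfaces). Two eikonal polynomials $f_1,f_2$ are congruent if $f_2(x)=\pm f_1(Ux)$ for some orthogonal transformation $U$. For a subspace $H\subset\mathbb{R}^n$, writing $\xi,\eta$ for the orthogonal projections of $x$ onto $H$ and $H^\perp$, the primitive quartic is $h_{4,H}=|\xi|^4-6|\xi|^2|\eta|^2+|\eta|^4$; up to congruence these are exactly the polynomials $(\sum_{i=1}^n x_i^2)^2-8(\sum_{i=1}^k x_i^2)(\sum_{i=k+1}^n x_i^2)$, $0\le k\le[n/2]$. *)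

(* Defs.v *)
From HB Require Import structures.
From mathcomp Require Import all_boot all_order all_algebra.
From mathcomp Require Import mpoly.
From mathcomp Require Import reals.
Set Implicit Arguments. Unset Strict Implicit. Unset Printing Implicit Defensive.
Import Order.TTheory GRing.Theory Num.Theory.
Local Open Scope ring_scope.

Section Defs.
Variables (R : realType) (n : nat).

Definition sqnorm (x : 'I_n -> R) : R := \sum_(i < n) x i ^+ 2.
Definition enorm (x : 'I_n -> R) : R := Num.sqrt (sqnorm x).

Definition grad_sq (f : {mpoly R[n]}) (x : 'I_n -> R) : R :=
  \sum_(i < n) (meval x (f^`M(i))) ^+ 2.

Definition laplacian (f : {mpoly R[n]}) : {mpoly R[n]} :=
  \sum_(i < n) (f^`M(i))^`M(i).

Definition eikonal (g : nat) (f : {mpoly R[n]}) : Prop :=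
  f \is g.-homog /\
  forall x : 'I_n -> R, grad_sq f x = (g ^ 2)%:R * enorm x ^+ (2 * g - 2).

(* Münzner–Cartan equations *)
Definition isoparametric (g : nat) (f : {mpoly R[n]}) : Prop :=
  eikonal g f /\
  exists m1 m2 : int, forall x : 'I_n -> R,
    meval x (laplacian f) = (m2 - m1)%:~R / 2 * (g ^ 2)%:R * enorm x ^+ (g - 2).

Definition orthogonal_mx (U : 'M[R]_n) : Prop := U *m U^T = 1%:M.

Definition act (U : 'M[R]_n) (x : 'I_n -> R) : 'I_n -> R :=
  fun i => \sum_(j < n) U i j * x j.

Definition congruent (f1 f2 : {mpoly R[n]}) : Prop :=
  exists (U : 'M[R]_n) (s : R), orthogonal_mx U /\ (s = 1 \/ s = -1) /\
    forall x : 'I_n -> R, meval x f2 = s * meval (act U x) f1.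

Definition prim_quartic (k : nat) : {mpoly R[n]} :=
  (\sum_(i < n) 'X_i ^+ 2) ^+ 2
  - 8%:R * (\sum_(i < n | (i < k)%N) 'X_i ^+ 2)
         * (\sum_(i < n | (k <= i)%N) 'X_i ^+ 2).

End Defs.

(* Main.v *)
Require Import Defs.
From HB Require Import structures.
From mathcomp Require Import all_boot all_order all_algebra.
From mathcomp Require Import mpoly.
From mathcomp Require Import reals.
From mathcomp Require Import ring lra.
From Stdlib Require Import Classical.
Import Order.TTheory GRing.Theory Num.Theory.
Local Open Scope ring_scope.
Set Implicit Arguments. Unset Strict Implicit. Unset Printing Implicit Defensive.

(** A quartic form with f = 1 at a unit vector e ("pole") which satisfies the eikonal
    equation has Hessian 12 on e and 4 or -12 on the orthogonal complement of e.  Let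
    V_e be the (-12)-eigenspace: f equals cos 4t on each great circle through e in a
    direction of V_e, and every point of the sphere with |f| < 1 lies on such a circle,
    since the integral curves of the spherical gradient are great circles.

    If all poles of f and -f have dim V_e >= 2, then the Laplacian, a quadratic form q,
    takes finitely many values at the poles (its value there is given by dim V_e).
    Rotating the direction in V_e moves the midpoint, a pole of -f, continuously, so q
    does not change there.  This forces q to be constant on each of the great circles;
    hence q takes finitely many values on the sphere and is a multiple of |x|^2.

    If some pole has dim V_e <= 1, the coefficients of the expansion of f at e are
    determined by one quadratic form, and f = +-(2 <Ax,x>^2 - |x|^4) for a symmetric
    involution A; diagonalising A gives the primitive quartic. *)

(** * Orthogonal projectors *)

Section Dot.
Variables (R : rcfType) (n : nat).
Implicit Types (x y z w : 'rV[R]_n) (a : R).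

Definition dot x y : R := \sum_i x 0 i * y 0 i.

Lemma dotC x y : dot x y = dot y x.
Proof. by apply: eq_bigr => i _; rewrite mulrC. Qed.

Lemma dotDl x y z : dot (x + y) z = dot x z + dot y z.
Proof. by rewrite -big_split; apply: eq_bigr => i _; rewrite mxE mulrDl. Qed.

Lemma dotZl a x y : dot (a *: x) y = a * dot x y.
Proof. by rewrite mulr_sumr; apply: eq_bigr => i _; rewrite mxE mulrA. Qed.

Lemma dotDr x y z : dot x (y + z) = dot x y + dot x z.
Proof. by rewrite dotC dotDl !(dotC x). Qed.

Lemma dotZr a x y : dot x (a *: y) = a * dot x y.
Proof. by rewrite dotC dotZl dotC. Qed.

Lemma dotNl x y : dot (- x) y = - dot x y.
Proof. by rewrite -scaleN1r dotZl mulN1r. Qed.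

Lemma dotNr x y : dot x (- y) = - dot x y.
Proof. by rewrite dotC dotNl dotC. Qed.

Lemma dot0l x : dot 0 x = 0.
Proof. by rewrite -(scale0r 0) dotZl mul0r. Qed.

Definition dotE := (dotDl, dotDr, dotNl, dotNr, dotZl, dotZr).

Lemma dot_ge0 x : 0 <= dot x x.
Proof. by apply: sumr_ge0 => i _; rewrite -expr2 sqr_ge0. Qed.

Lemma dot_eq0 x : dot x x = 0 -> x = 0.
Proof.
move=> /eqP; rewrite psumr_eq0 => [/allP h|i _]; last by rewrite -expr2 sqr_ge0.
apply/rowP => i; rewrite mxE.
by have := h i (mem_index_enum i); rewrite -expr2 sqrf_eq0 => /eqP.
Qed.

Lemma dot_inj x y : (forall w, dot x w = dot y w) -> x = y.
Proof.
by move=> h; apply/eqP; rewrite -subr_eq0; apply/eqP/dot_eq0; rewrite dotDl dotNl h subrr.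
Qed.

Lemma dot_delta x i : dot x (delta_mx 0 i) = x 0 i.
Proof.
rewrite /dot (bigD1 i) //= big1 ?addr0 => [|j ji]; first by rewrite mxE !eqxx mulr1.
by rewrite mxE (negPf ji) andbF mulr0.
Qed.

Lemma dot_mx11 x y : dot x y = (x *m y^T) 0 0.
Proof. by rewrite mxE; apply: eq_bigr => i _; rewrite mxE. Qed.

End Dot.

Lemma dot_mulmx (R : rcfType) m n (x : 'rV[R]_m) (y : 'rV[R]_n) (A : 'M_(m, n)) :
  dot (x *m A) y = dot x (y *m A^T).
Proof. by rewrite !dot_mx11 trmx_mul trmxK mulmxA. Qed.

Section Projector.
Variables (R : rcfType) (n : nat).
Implicit Types (x y z w : 'rV[R]_n) (a : R).

Lemma mulmx_outer x y z : x *m (y^T *m z) = dot x y *: z.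
Proof. by rewrite mulmxA [x *m y^T]mx11_scalar -dot_mx11 mul_scalar_mx. Qed.

Lemma tr_outer x y : \tr (x^T *m y) = dot x y.
Proof. by rewrite mxtrace_mulC /mxtrace big_ord1 -dot_mx11 dotC. Qed.

Lemma unit_scale x : x != 0 -> exists a, dot (a *: x) (a *: x) = 1.
Proof.
move=> x0; have d0 : 0 < dot x x.
  by rewrite lt_neqAle dot_ge0 andbT eq_sym; apply: contra x0 => /eqP/dot_eq0 ->.
exists (Num.sqrt (dot x x))^-1; rewrite !dotE mulrA -invfM -expr2 sqr_sqrtr ?ltW //.
by rewrite mulVf // gt_eqF.
Qed.

Lemma mx_row_eq (A B : 'M[R]_n) : (forall x, x *m A = x *m B) -> A = B.
Proof. by move=> h; apply/row_matrixP => i; rewrite !rowE h. Qed.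

(** Write [P] as column basis times row basis. Idempotency forces the product in the other order to
    be the identity of size [\rank P], and the trace is cyclic. *)
Lemma idem_trace (P : 'M[R]_n) : P *m P = P -> \tr P = (\rank P)%:R.
Proof.
move=> PP; have h : row_base P *m col_base P = 1%:M.
  apply: (row_free_inj (row_base_free P)); apply: (row_full_inj (col_base_full P)).
  have -> : 1%:M *m row_base P = row_base P by rewrite mul1mx.
  by rewrite -mulmxA mulmx_base mulmxA mulmx_base PP.
by rewrite -{1}(mulmx_base P) mxtrace_mulC h mxtrace1.
Qed.

Lemma sym_idem_unit (P : 'M[R]_n) : P *m P = P -> \tr P != 0 ->
  exists w, dot w w = 1 /\ w *m P = w.
Proof.
move=> PP tP; have /rowV0Pn [w /submxP[y yE] w0] : P != 0.
  by apply: contra tP => /eqP ->; rewrite mxtrace0.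
have [a aE] := unit_scale w0; exists (a *: w); split=> //.
by rewrite -scalemxAl yE -mulmxA PP.
Qed.

Section Deflate.
Variables (P : 'M[R]_n) (w : 'rV[R]_n).
Hypotheses (sP : P^T = P) (PP : P *m P = P) (w1 : dot w w = 1) (wP : w *m P = w).

Lemma deflate_sym : (P - w^T *m w)^T = P - w^T *m w.
Proof. by rewrite linearB /= trmx_mul trmxK sP. Qed.

Lemma deflate_idem : (P - w^T *m w) *m (P - w^T *m w) = P - w^T *m w.
Proof.
have Pw : P *m w^T = w^T by rewrite -[in LHS]sP -trmx_mul wP.
rewrite mulmxBl !mulmxBr PP.
have -> : P *m (w^T *m w) = w^T *m w by rewrite mulmxA Pw.
have -> : w^T *m w *m P = w^T *m w by rewrite -mulmxA wP.
by rewrite -mulmxA mulmx_outer w1 scale1r subrr subr0.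
Qed.

Lemma deflate_trace : \tr (P - w^T *m w) = \tr P - 1.
Proof. by rewrite linearB /= tr_outer w1. Qed.

Lemma deflate_fix y : y *m (P - w^T *m w) = y -> y *m P = y /\ dot y w = 0.
Proof.
move=> h; have yw : dot y w = 0.
  rewrite -h dot_mulmx deflate_sym mulmxBr wP mulmx_outer w1 scale1r subrr.
  by rewrite dotC dot0l.
by split=> //; rewrite -[RHS]h mulmxBr mulmx_outer yw scale0r subr0.
Qed.

End Deflate.

(** Induction on the trace: splitting off a unit vector of the image leaves an orthogonal projector
    whose trace is smaller by one. *)
Lemma sym_idem_onb r (P : 'M[R]_n) : P^T = P -> P *m P = P -> \tr P = r%:R ->
  exists B : 'M[R]_(r, n), B *m B^T = 1%:M /\ B^T *m B = P.
Proof.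
elim: r P => [|r IH] P sP PP tP.
  exists 0; split; first by apply/matrixP; case.
  rewrite mulmx0; move/eqP: tP; rewrite idem_trace // pnatr_eq0 mxrank_eq0.
  by move/eqP.
have [|w [w1 wP]] := sym_idem_unit PP; first by rewrite tP pnatr_eq0.
have [||| B [BB BP]] := IH (P - w^T *m w); rewrite ?deflate_sym ?deflate_idem //.
  by rewrite deflate_trace // tP mulrSr addrK.
(* The deflated projector kills [w], so the rows of [B] are orthogonal to [w]. *)
have wB : w *m B^T = 0.
  have : w *m (B^T *m B) = 0 by rewrite BP mulmxBr wP mulmx_outer w1 scale1r subrr.
  by rewrite mulmxA => /(congr1 (mulmx^~ B^T)); rewrite /= -mulmxA BB mulmx1 mul0mx.
pose C : 'M_(1 + r, n) := col_mx w B.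
have CC : C *m C^T = 1%:M.
  rewrite tr_col_mx mul_col_row wB BB -[B *m w^T]trmxK trmx_mul trmxK wB trmx0.
  by rewrite [w *m w^T]mx11_scalar -dot_mx11 w1 -scalar_mx_block.
have CP : C^T *m C = P by rewrite tr_col_mx mul_row_col BP addrC subrK.
by exists C; split; [exact: CC | exact: CP].
Qed.

End Projector.

(** * Symmetric involutions and primitive quartics *)

Section Involution.
Variables (R : realType) (n : nat).
Implicit Types (A : 'M[R]_n) (f : {mpoly R[n]}).

Lemma meval_prim_quartic k (x : 'I_n -> R) :
  meval x (prim_quartic R n k) = (\sum_i x i ^+ 2) ^+ 2 -
    8 * (\sum_(i < n | (i < k)%N) x i ^+ 2) * (\sum_(i < n | (k <= i)%N) x i ^+ 2).
Proof.
have sq P : meval x (\sum_(i < n | P i) 'X_i ^+ 2) = \sum_(i < n | P i) x i ^+ 2.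
  by rewrite raddf_sum; apply: eq_bigr => i _; rewrite /= [in LHS]expr2 mevalM !mevalXU.
by rewrite /prim_quartic mevalB [in LHS]expr2 !mevalM !sq rmorph_nat -expr2.
Qed.

(** For a symmetric involution [A] this is the orthogonal projector onto the eigenspace of 1, and
    [half_proj (- A)] is the one onto the eigenspace of -1. *)
Definition half_proj A : 'M[R]_n := 2^-1 *: (1%:M + A).

Lemma half_proj_sym A : A^T = A -> (half_proj A)^T = half_proj A.
Proof. by move=> sA; rewrite linearZ /= linearD /= sA trmx1. Qed.

Lemma half_proj_idem A : A *m A = 1%:M -> half_proj A *m half_proj A = half_proj A.
Proof.
move=> AA; rewrite -scalemxAl -scalemxAr mulmxDl !mulmxDr !mul1mx !mulmx1 AA.
by apply/matrixP => i j; rewrite !mxE; field.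
Qed.

Lemma half_projN A : half_proj (- A) = 1%:M - half_proj A.
Proof. by apply/matrixP => i j; rewrite !mxE; field. Qed.

Lemma dot_half_proj A x : dot (x *m half_proj A) x = (dot x x + dot (x *m A) x) / 2.
Proof. by rewrite -scalemxAr mulmxDr mulmx1 !dotE mulrC. Qed.

End Involution.

(** Stacked orthonormal bases of the two eigenspaces of [A] give the orthogonal matrix. If P and Q
    are the squared norms of the two components of x, then 2(P - Q)^2 - (P + Q)^2 = (P + Q)^2 -
    8PQ. *)
Lemma involution_congruent_le (R : realType) (p q : nat) (f : {mpoly R[p + q]})
    (A : 'M[R]_(p + q)) (s : R) :
  A^T = A -> A *m A = 1%:M -> s = 1 \/ s = -1 -> \tr (half_proj A) = p%:R ->
  (forall x : 'I_(p + q) -> R, let X := \row_i x i in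
    meval x f = s * (2 * dot (X *m A) X ^+ 2 - dot X X ^+ 2)) ->
  congruent (prim_quartic R (p + q) p) f.
Proof.
move=> sA AA s1 tA fE.
have [B [BB BE]] := sym_idem_onb (half_proj_sym sA) (half_proj_idem AA) tA.
have NN : (- A) *m (- A) = 1%:M by rewrite mulmxN mulNmx opprK.
have sN : (- A)^T = - A by rewrite linearN /= sA.
have tN : \tr (half_proj (- A)) = q%:R.
  by rewrite half_projN linearB /= mxtrace1 tA natrD addrAC subrr add0r.
have [C [CC CE]] := sym_idem_onb (half_proj_sym sN) (half_proj_idem NN) tN.
pose U : 'M_(p + q) := col_mx B C; exists U, s; split; last (split=> // x).
  apply: mulmx1C; rewrite tr_col_mx mul_row_col BE CE half_projN.
  by rewrite addrC subrK.
pose X : 'rV_(p + q) := \row_i x i.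
have UE i : act U x i = (X *m row_mx B^T C^T) 0 i.
  rewrite -tr_col_mx mxE; apply: eq_bigr => j _.
  by rewrite !mxE mulrC.
have sumB : \sum_(i < p + q | (i < p)%N) act U x i ^+ 2 = dot (X *m half_proj A) X.
  rewrite -BE mulmxA dot_mulmx /dot big_split_ord /= [X in _ + X]big_pred0.
    rewrite addr0; apply: eq_big => [i|i _]; first by rewrite /= ltn_ord.
    by rewrite UE mul_mx_row row_mxEl expr2.
  by move=> i /=; rewrite ltnNge leq_addr.
have sumC : \sum_(i < p + q | (p <= i)%N) act U x i ^+ 2 = dot (X *m half_proj (- A)) X.
  rewrite -CE mulmxA dot_mulmx /dot big_split_ord /= [X in X + _]big_pred0.
    rewrite add0r; apply: eq_big => [i|i _]; first by rewrite /= leq_addr.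
    by rewrite UE mul_mx_row row_mxEr expr2.
  by move=> i /=; rewrite leqNgt ltn_ord.
have sumU : \sum_i act U x i ^+ 2 =
    dot (X *m half_proj A) X + dot (X *m half_proj (- A)) X.
  rewrite -sumB -sumC (bigID (fun i : 'I_(p + q) => (i < p)%N)) /=; congr (_ + _).
  by apply: eq_bigl => i; rewrite -leqNgt.
rewrite fE meval_prim_quartic sumU sumB sumC !dot_half_proj mulmxN dotNl -/X.
by congr (_ * _); field.
Qed.

Lemma involution_congruent (R : realType) (n : nat) (f : {mpoly R[n]})
    (A : 'M[R]_n) (s : R) :
  A^T = A -> A *m A = 1%:M -> s = 1 \/ s = -1 ->
  (forall x : 'I_n -> R, let X := \row_i x i in
    meval x f = s * (2 * dot (X *m A) X ^+ 2 - dot X X ^+ 2)) ->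
  exists k : nat, (k <= n./2)%N /\ congruent (prim_quartic R n k) f.
Proof.
(* The form involves [A] only through a square, so [- A] serves as well and the smaller eigenspace
   may be put first; its dimension is then at most n/2. *)
wlog le_rk : A / (\rank (half_proj A) <= \rank (half_proj (- A)))%N.
  move=> wl sA AA s1 fE.
  have [le|/ltnW le] := leqP (\rank (half_proj A)) (\rank (half_proj (- A))).
    exact: wl le sA AA s1 fE.
  apply: (wl (- A)); rewrite ?opprK //; first by rewrite linearN /= sA.
    by rewrite mulmxN mulNmx opprK.
  by move=> x X; rewrite fE mulmxN dotNl sqrrN.
move=> sA AA s1 fE.
have NN : (- A) *m (- A) = 1%:M by rewrite mulmxN mulNmx opprK.
have tA := idem_trace (half_proj_idem AA).
have nE : n = (\rank (half_proj A) + \rank (half_proj (- A)))%N.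
  apply/eqP; rewrite -(eqr_nat R) natrD -!idem_trace ?half_proj_idem //.
  by rewrite half_projN linearB /= mxtrace1 addrC subrK.
move: le_rk tA nE; set p := \rank _; set q := \rank _.
move: p q => p q le_pq tA nE; exists p; split.
  by rewrite nE -[p in (p <= _)%N]doubleK half_leq // -addnn leq_add2l.
by subst n; apply: involution_congruent_le tA fE.
Qed.

(** * Polynomial identities *)

Section Poly.
Variable R : realFieldType.

(** The seven values at 0, 1, -1, 2, -2, 3, -3 determine a polynomial of degree at most 6, which
    leaves a linear system. *)
Lemma poly6_coef (a0 a1 a2 a3 a4 a5 a6 b0 b1 b2 b3 b4 b5 b6 : R) :
  (forall s, a0 + a1 * s + a2 * s ^+ 2 + a3 * s ^+ 3 + a4 * s ^+ 4 + a5 * s ^+ 5 + a6 * s ^+ 6 =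
    b0 + b1 * s + b2 * s ^+ 2 + b3 * s ^+ 3 + b4 * s ^+ 4 + b5 * s ^+ 5 + b6 * s ^+ 6) ->
  [/\ a0 = b0, a1 = b1, a2 = b2 & [/\ a3 = b3, a4 = b4, a5 = b5 & a6 = b6]].
Proof.
move=> h; have h0 := h 0; have h1 := h 1; have h2 := h (-1); have h3 := h 2.
have h4 := h (-2); have h5 := h 3; have h6 := h (-3).
by split; [lra|lra|lra|split; lra].
Qed.

Lemma poly_fun0 (p : {poly R}) : (forall t, p.[t] = 0) -> p = 0.
Proof.
move=> p0; apply/eqP/negPn/negP => pN0.
pose rs : seq R := [seq i%:R | i <- iota 0 (size p)].
have Urs : uniq rs.
  by rewrite map_inj_uniq ?iota_uniq // => i j /eqP; rewrite eqr_nat => /eqP.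
have rP : all (root p) rs by apply/allP => t _; apply/rootP.
by have := max_poly_roots pN0 rP Urs; rewrite size_map size_iota ltnn.
Qed.

(** The product of all [p - a *: q] vanishes at every point, hence is the zero polynomial, and
    polynomials form an integral domain. This replaces a continuity argument. *)
Lemma poly_finite_ratio (p q : {poly R}) (l : seq R) :
  (forall t, exists2 a, a \in l & p.[t] = a * q.[t]) -> exists2 a, a \in l & p = a *: q.
Proof.
move=> h; have : \prod_(a <- l) (p - a *: q) = 0.
  apply: poly_fun0 => t; have [a al pE] := h t; rewrite horner_prod.
  apply/eqP; rewrite prodf_seq_eq0; apply/hasP; exists a => //=.
  by rewrite !hornerE pE subrr.
move/eqP; rewrite prodf_seq_eq0 => /hasP[a al /=].
by rewrite subr_eq0 => /eqP; exists a.
Qed.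

(* With the rational parametrisation of the circle, a finite-valued quadratic
   function yields a polynomial identity with a single one of the values. *)
Lemma finite_on_circle (a0 a1 a2 a11 a12 a22 : R) (l : seq R) :
  (forall c s, c ^+ 2 + s ^+ 2 = 1 ->
    a0 + a1 * c + a2 * s + a11 * c ^+ 2 + a12 * (c * s) + a22 * s ^+ 2 \in l) ->
  [/\ a1 = 0, a2 = 0, a12 = 0 & a11 = a22].
Proof.
move=> h; pose d : {poly R} := 1 + 'X ^+ 2; pose e : {poly R} := 1 - 'X ^+ 2.
pose u : {poly R} := 2%:P * 'X.
(* [p] is the quadratic function at c = e/d, s = u/d, cleared of denominators by d^2. *)
pose p := a0 *: d ^+ 2 + a1 *: (d * e) + a2 *: (d * u) + a11 *: e ^+ 2
  + a12 *: (e * u) + a22 *: u ^+ 2.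
have dE t : d.[t] = 1 + t ^+ 2 by rewrite !hornerE.
have pE t : p.[t] = a0 * (1 + t ^+ 2) ^+ 2 + a1 * ((1 + t ^+ 2) * (1 - t ^+ 2))
  + a2 * ((1 + t ^+ 2) * (2 * t)) + a11 * (1 - t ^+ 2) ^+ 2
  + a12 * ((1 - t ^+ 2) * (2 * t)) + a22 * (2 * t) ^+ 2.
  by rewrite /p /d /e /u !hornerE; ring.
have [t|a al paE] := @poly_finite_ratio p (d ^+ 2) l.
  have d0 : 1 + t ^+ 2 != 0 by rewrite gt_eqF // ltr_wpDr ?sqr_ge0.
  have /h hl : ((1 - t ^+ 2) / (1 + t ^+ 2)) ^+ 2 + (2 * t / (1 + t ^+ 2)) ^+ 2 = 1.
    by field.
  by eexists; first exact: hl; rewrite pE horner_exp dE; field.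
have q t : p.[t] = a * (1 + t ^+ 2) ^+ 2 by rewrite paE hornerZ horner_exp dE.
have q0 := q 0; have q1 := q 1; have q2 := q (-1); have q3 := q 2; have q4 := q (-2).
by rewrite !pE in q0 q1 q2 q3 q4; split; lra.
Qed.

(** The coefficients of degree 0, 1 and 2 of the product kill [b0], [b1] and [b2] in turn. *)
Lemma quadratic_mul_eq0 (a0 a1 a2 b0 b1 b2 : R) :
  (forall t, (a0 + a1 * t + a2 * t ^+ 2) * (b0 + b1 * t + b2 * t ^+ 2) = 0) ->
  a0 != 0 -> b2 = 0.
Proof.
move=> h a0N; have [|e0 e1 e2 _] := @poly6_coef (a0 * b0) (a0 * b1 + a1 * b0)
  (a0 * b2 + a1 * b1 + a2 * b0) (a1 * b2 + a2 * b1) (a2 * b2) 0 0 0 0 0 0 0 0 0.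
  by move=> s; have := h s; lra.
have b00 : b0 = 0 by apply: (mulfI a0N); rewrite e0 mulr0.
have b10 : b1 = 0 by apply: (mulfI a0N); rewrite mulr0 -e1 b00; ring.
by apply: (mulfI a0N); rewrite mulr0 -e2 b00 b10; ring.
Qed.

End Poly.

(** Square roots of (1 + a)/2 and (1 - a)/2 are the cosine and sine of the half angle, up to a sign
    that is fixed by the sign of [b]. *)
Lemma half_angle (R : rcfType) (a b : R) : a ^+ 2 + b ^+ 2 = 1 ->
  exists c s, [/\ c ^+ 2 + s ^+ 2 = 1, a = c ^+ 2 - s ^+ 2 & b = 2 * c * s].
Proof.
move=> ab; have b2 : 0 <= b ^+ 2 by exact: sqr_ge0.
have [a1 a2] : 0 <= (1 + a) / 2 /\ 0 <= (1 - a) / 2 by split; nra.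
wlog b0 : b ab b2 / 0 <= b.
  move=> wl; have [|/ltW] := leP 0 b; first exact: wl.
  rewrite -oppr_ge0 => /(wl (- b)); rewrite sqrrN => /(_ ab b2) [c [s [h1 h2 h3]]].
  by exists c, (- s); split; rewrite ?sqrrN //; lra.
pose c := Num.sqrt ((1 + a) / 2); pose s := Num.sqrt ((1 - a) / 2).
have [c2 s2] : c ^+ 2 = (1 + a) / 2 /\ s ^+ 2 = (1 - a) / 2 by rewrite !sqr_sqrtr.
exists c, s; split; [lra | lra |].
have cs0 : 0 <= 2 * c * s by rewrite !mulr_ge0 ?sqrtr_ge0.
apply/eqP; rewrite -(eqrXn2 (n := 2)) //; apply/eqP.
by rewrite !exprMn c2 s2; lra.
Qed.

Lemma quarter_angle (R : rcfType) (a b : R) : a ^+ 2 + b ^+ 2 = 1 ->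
  exists c s, [/\ c ^+ 2 + s ^+ 2 = 1, a = c ^+ 4 - 6 * c ^+ 2 * s ^+ 2 + s ^+ 4
    & b = 4 * c ^+ 3 * s - 4 * c * s ^+ 3].
Proof.
move=> /half_angle[c [s [/half_angle[c' [s' [cs' -> ->]]] -> ->]]].
by exists c', s'; split=> //; ring.
Qed.

(** * Eikonal quartic forms and their poles *)

Section Form.
Variables (R : rcfType) (n : nat).
Notation V := 'rV[R]_n.
Implicit Types (T : V -> V -> V -> V) (x y z w e v : V).

(* A quartic form is handled through its polarisation: [dot (T x y z) w] is the
   symmetric 4-linear form, so the gradient of [dot (T x x x) x] is [4 T x x x]. *)
Record sym4 T : Prop := Sym4 {
  sym4_lin : forall a x x' y z, T (a *: x + x') y z = a *: T x y z + T x' y z;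
  sym4_12 : forall x y z, T x y z = T y x z;
  sym4_23 : forall x y z, T x y z = T x z y;
  sym4_34 : forall x y z w, dot (T x y z) w = dot (T x y w) z }.

(** The factor 16 of the eikonal equation cancels against the square of the gradient [4 T x x x]. *)
Definition eik T := forall x, dot (T x x x) (T x x x) = dot x x ^+ 3.

Definition oppT T x y z := - T x y z.

Lemma oppT_sym4 T : sym4 T -> sym4 (oppT T).
Proof.
case=> h1 h2 h3 h4; split=> *; rewrite /oppT; first by rewrite h1 opprD scalerN.
- by rewrite h2.
- by rewrite h3.
- by rewrite !dotNl h4.
Qed.

Lemma oppT_eik T : eik T -> eik (oppT T).
Proof. by move=> h x; rewrite /oppT dotNl dotNr opprK h. Qed.

Definition fmx T x y : 'M[R]_n := \matrix_(i, j) T x y (delta_mx 0 i) 0 j.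
(** The Hessian of the quartic at [x] is 12 times [fmx T x x], so [tau T x x] is a twelfth of the
    Laplacian. *)
Definition tau T x y : R := \tr (fmx T x y).

Lemma tau_opp T x y : tau (oppT T) x y = - tau T x y.
Proof. by rewrite /tau -linearN /=; congr (\tr _); apply/matrixP => i j; rewrite !mxE. Qed.

Definition pole T e := dot e e = 1 /\ dot (T e e e) e = 1.
(** The eigenvalue -1 of [T e e] is the eigenvalue -12 of the Hessian. *)
Definition normal T e v := dot v v = 1 /\ T e e v = - v.

Section Theory.
Variable T : V -> V -> V -> V.
Hypotheses (hT : sym4 T) (hE : eik T).

Let T12 := sym4_12 hT.
Let T23 := sym4_23 hT.
Let T34 := sym4_34 hT.

Lemma TZ1 a x y z : T (a *: x) y z = a *: T x y z.
Proof.
have T0 : T 0 y z = 0.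
  have := sym4_lin hT (-1) 0 0 y z; rewrite scaler0 addr0 scaleN1r => ->.
  by rewrite addNr.
by rewrite -[a *: x]addr0 (sym4_lin hT) T0 addr0.
Qed.

Lemma TD1 x x' y z : T (x + x') y z = T x y z + T x' y z.
Proof. by rewrite -{1}[x]scale1r (sym4_lin hT) scale1r. Qed.

Lemma TZ2 a x y z : T x (a *: y) z = a *: T x y z.
Proof. by rewrite T12 TZ1 T12. Qed.

Lemma TD2 x y y' z : T x (y + y') z = T x y z + T x y' z.
Proof. by rewrite T12 TD1 !(T12 _ x). Qed.

Lemma TZ3 a x y z : T x y (a *: z) = a *: T x y z.
Proof. by rewrite T23 TZ2 T23. Qed.

Lemma TD3 x y z z' : T x y (z + z') = T x y z + T x y z'.
Proof. by rewrite T23 TD2 !(T23 _ y). Qed.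

Lemma TN1 x y z : T (- x) y z = - T x y z.
Proof. by rewrite -scaleN1r TZ1 scaleN1r. Qed.

Lemma TN2 x y z : T x (- y) z = - T x y z.
Proof. by rewrite T12 TN1 T12. Qed.

Lemma TN3 x y z : T x y (- z) = - T x y z.
Proof. by rewrite T23 TN2 T23. Qed.

Definition TE := (TD1, TD2, TD3, TZ1, TZ2, TZ3, TN1, TN2, TN3).

Lemma mulmx_fmx x y z : z *m fmx T x y = T x y z.
Proof.
apply/rowP => j; rewrite -[RHS]dot_delta T34 dotC !mxE; apply: eq_bigr => i _.
by rewrite mxE -[in LHS]dot_delta T34 dot_delta.
Qed.

Lemma fmx_sym x y : (fmx T x y)^T = fmx T x y.
Proof. by apply/matrixP => i j; rewrite !mxE -dot_delta T34 dot_delta. Qed.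

Lemma tauC x y : tau T x y = tau T y x.
Proof. by rewrite /tau; congr (\tr _); apply/matrixP => i j; rewrite !mxE T12. Qed.

Lemma tauDl x x' y : tau T (x + x') y = tau T x y + tau T x' y.
Proof. by rewrite /tau -linearD; congr (\tr _); apply/matrixP => i j; rewrite !mxE TD1 mxE. Qed.

Lemma tauZl a x y : tau T (a *: x) y = a * tau T x y.
Proof. by rewrite /tau -linearZ; congr (\tr _); apply/matrixP => i j; rewrite !mxE TZ1 mxE. Qed.

Lemma tauDr x y y' : tau T x (y + y') = tau T x y + tau T x y'.
Proof. by rewrite tauC tauDl !(tauC x). Qed.

Lemma tauZr a x y : tau T x (a *: y) = a * tau T x y.
Proof. by rewrite tauC tauZl tauC. Qed.

Definition tauE := (tauDl, tauDr, tauZl, tauZr).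

(** These are the coefficients of s, s^2 and s^3 in the eikonal identity along [x + s *: y], divided
    by 6, 3 and 2. *)
Lemma eik_coef x y :
  [/\ dot (T x x x) (T x x y) = dot x x ^+ 2 * dot x y,
      3 * dot (T x x y) (T x x y) + 2 * dot (T x x x) (T x y y)
        = dot x x ^+ 2 * dot y y + 4 * dot x x * dot x y ^+ 2
    & dot (T x x x) (T y y y) + 9 * dot (T x x y) (T x y y)
        = 6 * dot x x * dot x y * dot y y + 4 * dot x y ^+ 3].
Proof.
set A := T x x x; set B := T x x y; set C := T x y y; set D := T y y y.
have [|_ e1 e2 [e3 _ _ _]] := @poly6_coef _ (dot A A) (6 * dot A B)
   (9 * dot B B + 6 * dot A C) (2 * dot A D + 18 * dot B C) (9 * dot C C + 6 * dot B D)
   (6 * dot C D) (dot D D) (dot x x ^+ 3) (6 * dot x x ^+ 2 * dot x y)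
   (3 * dot x x ^+ 2 * dot y y + 12 * dot x x * dot x y ^+ 2)
   (12 * dot x x * dot x y * dot y y + 8 * dot x y ^+ 3)
   (3 * dot y y ^+ 2 * dot x x + 12 * dot y y * dot x y ^+ 2)
   (6 * dot y y ^+ 2 * dot x y) (dot y y ^+ 3).
  move=> s; have := hE (x + s *: y).
  have -> : T (x + s *: y) (x + s *: y) (x + s *: y) =
      A + (3 * s) *: B + (3 * s ^+ 2) *: C + s ^+ 3 *: D.
    rewrite !TE (T12 y x x) (T23 x y x) (T12 y x y) (T23 y y x) (T12 y x y).
    by apply/rowP => i; rewrite !mxE; ring.
  rewrite !dotE (dotC B A) (dotC C A) (dotC D A) (dotC C B) (dotC D B) (dotC D C).
  by rewrite (dotC y x) => h; lra.
split; lra.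
Qed.

(** Equality case of Cauchy-Schwarz: [T e e e] and [e] are unit vectors with inner product 1. *)
Lemma pole_fix e : pole T e -> T e e e = e.
Proof.
move=> [e1 eT]; have h := hE e; rewrite e1 expr1n in h.
apply/eqP; rewrite -subr_eq0; apply/eqP/dot_eq0.
by rewrite !dotE h (dotC e) eT e1; ring.
Qed.

(** * The Hessian at a pole and its eigenspaces *)

Section Pole.
Variable e : V.
Hypothesis he : pole T e.
Let e1 : dot e e = 1 := he.1.
Let eT : T e e e = e := pole_fix he.

Lemma dot_pole y : dot (T e e y) e = dot e y.
Proof. by rewrite -T34 eT. Qed.

(** Polarised second-order coefficient at [e]. On the complement of [e] it says that S = [T e e]
    satisfies 3 S^2 + 2 S = 1, whence the eigenvalues 1/3 and -1. *)
Lemma pole_hess_sq x y :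
  3 * dot (T e e x) (T e e y) + 2 * dot (T e e x) y = dot x y + 4 * dot e x * dot e y.
Proof.
have q z : 3 * dot (T e e z) (T e e z) + 2 * dot (T e e z) z = dot z z + 4 * dot e z ^+ 2.
  have [_ + _] := eik_coef e z; rewrite eT e1 (dotC e (T e z z)) (T34 e z z e) (T23 e z e) => h.
  by lra.
have := q (x + y); rewrite TD3 !dotE; have := q x; have := q y.
rewrite (dotC (T e e y) (T e e x)) (dotC y x) (T34 e e y x).
lra.
Qed.

Lemma pole_hess_sqE x :
  T e e (T e e x) = 3^-1 *: (x + (4 * dot e x) *: e - 2 *: T e e x).
Proof.
apply: dot_inj => w; have := pole_hess_sq x w.
by rewrite (T34 e e (T e e x)) (dotC (T e e w)) !dotE => h; lra.
Qed.

(** The orthogonal projector onto the eigenspace of -1: (1 - 3 S)/4 is 0 for S = 1/3 and 1 for S =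
    -1, and the outer product of [e] corrects its value at [e] itself to 0. *)
Definition pole_proj : 'M[R]_n :=
  4^-1 *: (1%:M + 2 *: (e^T *m e) - 3 *: fmx T e e).

Lemma mul_pole_proj x : x *m pole_proj = 4^-1 *: (x + (2 * dot x e) *: e - 3 *: T e e x).
Proof.
rewrite -scalemxAr mulmxBr mulmxDr mulmx1 -!scalemxAr mulmx_outer scalerA.
by rewrite (mulmx_fmx e e x).
Qed.

Lemma pole_proj_sym : pole_proj^T = pole_proj.
Proof.
apply/matrixP => i j; have := congr1 (fun A : 'M_n => A i j) (fmx_sym e e).
by rewrite !mxE !big_ord1 !mxE => <-; rewrite eq_sym (mulrC (e 0 i)).
Qed.

Lemma hess_pole_proj x : T e e (x *m pole_proj) = - (x *m pole_proj).
Proof.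
rewrite mul_pole_proj !TE eT pole_hess_sqE (dotC e).
by apply/rowP => i; rewrite !mxE; field.
Qed.

Lemma dot_pole_proj x : dot (x *m pole_proj) e = 0.
Proof. by rewrite mul_pole_proj !dotE dot_pole (dotC e) e1; field. Qed.

Lemma pole_proj_idem : pole_proj *m pole_proj = pole_proj.
Proof.
apply: mx_row_eq => x; rewrite mulmxA [in LHS]mul_pole_proj hess_pole_proj dot_pole_proj.
by apply/rowP => i; rewrite !mxE; field.
Qed.

Lemma tau_pole : 3 * tau T e e = n.+2%:R - 4 * (\rank pole_proj)%:R.
Proof.
rewrite -idem_trace ?pole_proj_idem // /pole_proj linearZ /= linearB /= linearD /=.
rewrite !linearZ /= mxtrace1 tr_outer e1 -[n.+2]addn2 natrD -/(tau T e e).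
by field.
Qed.

Lemma pole_projP v : reflect (T e e v = - v) (v *m pole_proj == v).
Proof.
apply: (iffP eqP) => [<-|hv]; first exact: hess_pole_proj.
have ve : dot v e = 0.
  have := dot_pole v; rewrite hv dotNl (dotC e) => h; lra.
rewrite mul_pole_proj hv ve.
by apply/rowP => i; rewrite !mxE; field.
Qed.

Lemma eq_dot_normal v : T e e v = - v -> dot e v = 0.
Proof. by move/pole_projP/eqP <-; rewrite dotC dot_pole_proj. Qed.

(* On the complement of [e] the operator [T e e] has the eigenvalues 1/3 and -1 only,
   whereas its Rayleigh quotient at [T e v v + e] would be 5/3. *)
Lemma normal_evv v : normal T e v -> T e v v = - e.
Proof.
move=> [v1 hv]; have ev := eq_dot_normal hv.
(* [K] is the third-order coefficient of the eikonal identity at [e]; it vanishes in directions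
   orthogonal to [e]. *)
pose K y := dot e (T y y y) + 9 * dot (T e e y) (T e y y).
have K0 y : dot e y = 0 -> K y = 0.
  by move=> ey; have [_ _] := eik_coef e y; rewrite eT ey /K => ->; ring.
have [z zE] : exists z, z = T e v v + e by exists (T e v v + e).
have Tve : dot (T e v v) e = -1 by rewrite T34 T23 hv dotNl v1.
have ez : dot e z = 0 by rewrite zE dotC dotDl Tve e1 addNr.
have Sze : dot (T e e z) e = 0 by rewrite dot_pole.
have E1 : T e v v = z - e by rewrite zE addrK.
(* The combination K(v + z) - K(v - z) - 2 K(z) isolates the part of the cubic form [K] that is
   quadratic in [v] and linear in [z]. *)
have zz : 9 * dot (T e e z) z = 15 * dot z z.
  have := K0 (v + z); have := K0 (v - z); have := K0 z ez; rewrite /K.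
  rewrite !TE (T12 z v v) (T23 v z v) (T23 z z v) (T12 z v z).
  rewrite (T23 e z v) hv !dotE ez ev (dotC e (T v v z)) (T34 v v z e) (T23 v v e) (T12 v e v).
  rewrite !(dotC v) (T34 e v z v) E1 !dotE ez Sze => h1 h2 h3.
  by have := h2 (subrr _); have := h3 (addr0 _); lra.
(* Together with [zz] this gives 9 |T e e z|^2 = -7 |z|^2, so both sides vanish. *)
have := pole_hess_sq z z; rewrite ez => h.
have S0 := dot_ge0 (T e e z); have z0 := dot_ge0 z.
have -> : T e v v = z - e by [].
suff -> : z = 0 by rewrite sub0r.
by apply: dot_eq0; lra.
Qed.

(** Second-order coefficient of the eikonal identity at [v] in the direction [e], where [T v v e] is
    [- e] and [T v e e] is [- v]. *)
Lemma normal_vvv v : normal T e v -> pole T v.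
Proof.
move=> hv; have [v1 ev] := hv; have vv := normal_evv hv.
have := eik_coef v e => -[_ + _].
rewrite (T23 v v e) (T12 v e v) (T12 v e e) (T23 e v e) vv ev !dotE e1 v1 (dotC v e).
by rewrite (eq_dot_normal ev) => h; split=> //; lra.
Qed.

End Pole.

(* On the circle through [e] and [v] the form is cos 4t, so a pole of the opposite
   form lies halfway. *)
Lemma normal_midpoint e v : pole T e -> normal T e v ->
  exists r, [/\ r ^+ 2 = 2^-1, pole (oppT T) (r *: (e + v))
    & normal (oppT T) (r *: (e + v)) (r *: (e - v))].
Proof.
move=> he hv; have [v1 ev] := hv; have vv := normal_evv he hv.
have eT := pole_fix he; have vT := pole_fix (normal_vvv he hv).
have ve0 := eq_dot_normal he ev; have e1 := he.1.
have r2 : Num.sqrt (2^-1 : R) ^+ 2 = 2^-1 by rewrite sqr_sqrtr // invr_ge0 ler0n.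
move: r2; set r := Num.sqrt _; move: r => r r2; exists r.
have E1 : T (e + v) (e + v) (e + v) = - (2 *: (e + v)).
  rewrite !TE (T12 v e e) (T23 e v e) (T12 v e v) (T23 v v e) (T12 v e v) eT ev vv vT.
  by apply/rowP => i; rewrite !mxE; ring.
have E2 : T (e + v) (e + v) (e - v) = 2 *: (e - v).
  rewrite !TE (T12 v e e) (T23 e v e) (T12 v e v) (T23 v v e) (T12 v e v) eT ev vv vT.
  by apply/rowP => i; rewrite !mxE; ring.
split=> //; split; rewrite /oppT ?TZ1 ?TZ2 ?TZ3 ?E1 ?E2 ?dotE ?(dotC v e) ?e1 ?v1 ?ve0.
- by nra.
- by nra.
- by nra.
- apply/rowP => i; rewrite !mxE.
  by have := congr1 (fun t => t * (r * (e 0 i - v 0 i))) r2; rewrite /=; lra.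
Qed.

(* [w] is the normalised spherical gradient at [x]; gradient lines are great circles. *)
Lemma pole_circle x : dot x x = 1 -> dot (T x x x) x ^+ 2 != 1 ->
  exists e v c s, [/\ pole T e, normal T e v, c ^+ 2 + s ^+ 2 = 1 & x = c *: e + s *: v].
Proof.
move=> x1; have [f fT] : exists f, dot (T x x x) x = f by eexists.
rewrite fT => f1; pose g := T x x x.
have gg : dot g g = 1 by rewrite hE x1 expr1n.
have gx : dot g x = f by exact: fT.
have f2 : 0 < 1 - f ^+ 2.
  rewrite lt_neqAle eq_sym subr_eq0 eq_sym f1 /=.
  by have := dot_ge0 (g - f *: x); rewrite !dotE gg (dotC x) gx x1; lra.
pose r := Num.sqrt (1 - f ^+ 2).
have r2 : r ^+ 2 = 1 - f ^+ 2 by rewrite sqr_sqrtr // ltW.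
have r0 : r != 0 by rewrite gt_eqF // sqrtr_gt0.
have [w wE] : exists w, w = r^-1 *: (g - f *: x) by eexists.
have gE : g = f *: x + r *: w.
  by rewrite wE scalerA divff // scale1r addrC subrK.
have xw : dot x w = 0 by rewrite wE !dotE (dotC x) gx x1 mulr1 subrr mulr0.
have w1 : dot w w = 1.
  have := gg; rewrite gE !dotE (dotC w) xw x1 => h.
  apply: (mulfI (mulf_neq0 r0 r0)); lra.
have xxg : T x x g = x.
  apply: dot_inj => y; rewrite T34.
  by have [+ _ _] := eik_coef x y; rewrite x1 expr1n mul1r -/g dotC.
have xxw : T x x w = r *: x - f *: w.
  have -> : T x x w = r^-1 *: (T x x g - f *: g).
    by rewrite wE !TE -/g.
  rewrite xxg gE; apply/rowP => i; rewrite !mxE; apply: (mulfI r0).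
  rewrite mulVKf //; have := congr1 (fun t => t * x 0 i) r2; rewrite /=; lra.
have Fxww : dot (T x w w) x = - f.
  by rewrite T34 T23 xxw !dotE xw w1; ring.
have := eik_coef x w => -[_ + +].
rewrite -/g x1 w1 xw xxw gE !dotE x1 w1 (dotC w x) xw (dotC x (T x w w)) Fxww.
rewrite (dotC x (T w w w)) (dotC w (T x w w)) (T34 w w w x) (T23 w w x) (T12 w x w).
rewrite (dotC w (T w w w)).
move=> h3 h4.
have Fxwww : dot (T x w w) w = - r by apply: (mulfI r0); lra.
have Fwwww : dot (T w w w) w = f by apply: (mulfI r0); rewrite Fxwww in h4; lra.
have Fxxxw : dot (T x x x) w = r by rewrite -/g gE !dotE xw w1; ring.
have Fxxwx : dot (T x x w) x = r by rewrite T34.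
have Fxxww : dot (T x x w) w = - f by rewrite xxw !dotE xw w1; ring.
have Fwwwx : dot (T w w w) x = - r by rewrite T34 T23 T12 -Fxwww.
(* On the circle of [x] and [w] the polarised form takes the values f, r, -f, -r, f, so it is f cos
   4t + r sin 4t. The angle with f = cos 4t, r = sin 4t is where it attains 1. *)
have [|c [s [cs fE rE]]] := @quarter_angle R f r; first by rewrite r2; ring.
have [e eE] : exists e, e = c *: x + s *: w by eexists.
have [v vE] : exists v, v = c *: w - s *: x by eexists.
have nrm := (T12 w x x, T23 x w x, T12 w x w, T23 w w x).
have val := (fT, Fxxxw, Fxxwx, Fxxww, Fxww, Fxwww, Fwwwx, Fwwww).
have fr : f * (c ^+ 4 - 6 * c ^+ 2 * s ^+ 2 + s ^+ 4)
    + r * (4 * c ^+ 3 * s - 4 * c * s ^+ 3) = 1.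
  by rewrite -fE -rE -!expr2 r2; ring.
have he : pole T e.
  split; first by rewrite eE !dotE x1 w1 (dotC w) xw -[RHS]cs; ring.
  by rewrite eE !TE !nrm !dotE !val -[RHS]fr; ring.
have v1 : dot v v = 1 by rewrite vE !dotE x1 w1 (dotC w) xw -[RHS]cs; ring.
have ev : dot e v = 0 by rewrite eE vE !dotE x1 w1 (dotC w) xw; ring.
have eevv : dot (T e e v) v = -1.
  by rewrite eE vE !TE !nrm !dotE !val -[in RHS]fr; ring.
exists e, v, c, (- s); split=> //; last 2 first.
- by rewrite sqrrN.
- rewrite eE vE; apply/rowP => i; rewrite !mxE.
  by have := congr1 (fun t => t * x 0 i) cs; rewrite /=; lra.
(* [pole_hess_sq] gives [T e e v] norm 1, and its inner product with [v] is -1, so it equals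
   [- v]. *)
split=> //; apply/eqP; rewrite -subr_eq0 opprK; apply/eqP/dot_eq0.
have := pole_hess_sq he v v; rewrite !dotE (dotC v (T e e v)) ev v1 eevv; lra.
Qed.

End Theory.
End Form.

(** * Poles with large normal spaces *)

Section Radial.
Variables (R : rcfType) (n : nat).
Notation V := 'rV[R]_n.
Implicit Types (T : V -> V -> V -> V) (x y z w e v : V).

Definition large_poles T := forall e, pole T e -> (1 < \rank (pole_proj T e))%N.

(** The candidates for [3 * tau T e e] from [tau_pole], closed under negation so as to cover the
    poles of [oppT T] too. *)
Definition pole_values : seq R :=
  let l := [seq n.+2%:R - 4 * k%:R | k <- iota 0 n.+1] in l ++ map -%R l.

Lemma pole_valuesN a : a \in pole_values -> - a \in pole_values.
Proof.
rewrite !mem_cat => /orP[h|/mapP[b h ->]]; first by rewrite map_f ?orbT.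
by rewrite opprK h.
Qed.

Lemma tau_pole_values T e : sym4 T -> eik T -> pole T e -> 3 * tau T e e \in pole_values.
Proof.
move=> hT hE he; rewrite tau_pole // mem_cat; apply/orP; left.
apply/mapP; exists (\rank (pole_proj T e)) => //.
by rewrite mem_iota add0n ltnS rank_leq_row.
Qed.

(** Removing [v] from the projector leaves trace [\rank (pole_proj T e)] minus 1, which is
    nonzero. *)
Lemma normal_orthogonal T e v : sym4 T -> eik T -> pole T e ->
  (1 < \rank (pole_proj T e))%N -> normal T e v -> exists2 w, normal T e w & dot v w = 0.
Proof.
move=> hT hE he rk [v1 /(pole_projP hT hE he)/eqP vP].
have sP := pole_proj_sym hT e; have PP := pole_proj_idem hT hE he.
have [|w [w1 wP]] := sym_idem_unit (deflate_idem sP PP v1 vP).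
  rewrite deflate_trace // (idem_trace PP) subr_eq0 -[1]/(1%:R) eqr_nat.
  by rewrite neq_ltn rk orbT.
have [wP' wv] := deflate_fix sP v1 vP wP; exists w; last by rewrite dotC.
by split=> //; apply/(pole_projP hT hE he)/eqP.
Qed.

(* The midpoints (e + u)/sqrt 2, u in the unit sphere of the normal space, are poles
   of [oppT T], where the trace takes finitely many values. *)
Lemma tau_normal0 T e v : sym4 T -> eik T -> large_poles T ->
  pole T e -> normal T e v -> tau T e v = 0.
Proof.
move=> hT hE hl he hv.
have [w hw vw] := normal_orthogonal hT hE he (hl _ he) hv.
(* The function is 3 tau of [oppT T] at r(e + c v + s w); the factors come from r^2 = 1/2. *)
have [|b0 _ _ _] := @finite_on_circle R (- (3 / 2) * tau T e e) (- 3 * tau T e v)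
  (- 3 * tau T e w) (- (3 / 2) * tau T v v) (- 3 * tau T v w) (- (3 / 2) * tau T w w)
  pole_values; last by lra.
move=> c s cs; have hu : normal T e (c *: v + s *: w).
  case: hv hw => [v1 ev] [w1 ew]; split.
    by rewrite !dotE v1 w1 (dotC w) vw -[RHS]cs; ring.
  by rewrite (TD3 hT) !(TZ3 hT) ev ew opprD !scalerN.
have [r [r2 hm _]] := normal_midpoint hT hE he hu.
have := tau_pole_values (oppT_sym4 hT) (oppT_eik hE) hm; rewrite tau_opp.
rewrite !(tauE hT) (tauC hT v e) (tauC hT w e) (tauC hT w v).
move=> h; apply: (eq_ind _ (fun t => t \in pole_values) h).
transitivity (- 3 * r ^+ 2 * (tau T e e + 2 * c * tau T e v + 2 * s * tau T e w
  + c ^+ 2 * tau T v v + 2 * c * s * tau T v w + s ^+ 2 * tau T w w)); first by ring.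
by rewrite r2; field.
Qed.

(** The vanishing of [tau_normal0], applied to [oppT T] at the midpoint, reads tau(e + v, e - v) =
    0. *)
Lemma tau_normal_eq T e v : sym4 T -> eik T -> large_poles T -> large_poles (oppT T) ->
  pole T e -> normal T e v -> tau T e e = tau T v v.
Proof.
move=> hT hE hl hl' he hv; have [r [r2 hm hm']] := normal_midpoint hT hE he hv.
have := tau_normal0 (oppT_sym4 hT) (oppT_eik hE) hl' hm hm'.
rewrite tau_opp -[e - v]/(e + - v) -scaleN1r !(tauE hT) (tauC hT v e) => h.
have r0 : r ^+ 2 != 0 by rewrite r2 invr_neq0 // pnatr_eq0.
by apply: (mulfI r0); lra.
Qed.

(** On the circle through [e] and [v], tau has no cross term and equal diagonal terms, so its value
    at [x] is that at the pole [e]. *)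
Lemma tau_unit T x : sym4 T -> eik T -> large_poles T -> large_poles (oppT T) ->
  dot x x = 1 -> 3 * tau T x x \in pole_values.
Proof.
move=> hT hE hl hl' x1; have [/eqP|f1] := eqVneq (dot (T x x x) x ^+ 2) 1.
  rewrite sqrf_eq1 => /orP[] /eqP f1; first by apply: tau_pole_values.
  have hx : pole (oppT T) x by split; rewrite ?dotNl ?f1 ?opprK.
  rewrite -[_ * _]opprK; apply: pole_valuesN; rewrite -mulrN -tau_opp.
  exact: tau_pole_values (oppT_sym4 hT) (oppT_eik hE) hx.
have [e [v [c [s [he hv cs ->]]]]] := pole_circle hT hE x1 f1.
have h := tau_pole_values hT hE he; apply: (eq_ind _ (fun t => t \in pole_values) h).
rewrite !(tauE hT) (tauC hT v e) (tau_normal0 hT hE hl he hv).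
rewrite -(tau_normal_eq hT hE hl hl' he hv).
have := congr1 (fun t => t * tau T e e) cs; rewrite /=; lra.
Qed.

Definition contraction T y : V := \sum_i T y (delta_mx 0 i) (delta_mx 0 i).

Lemma tau_contraction T x y : sym4 T -> tau T x y = dot x (contraction T y).
Proof.
move=> hT; rewrite tauC // dotC /tau /mxtrace /contraction.
have -> : dot (\sum_i T y (delta_mx 0 i) (delta_mx 0 i)) x =
    \sum_i dot (T y (delta_mx 0 i) (delta_mx 0 i)) x.
  by apply: (big_morph (fun t => dot t x)) => [t u|]; rewrite ?dotDl ?dot0l.
apply: eq_bigr => i _; rewrite mxE -dot_delta.
by rewrite [RHS](sym4_34 hT) (sym4_23 hT y x).
Qed.

(** Finitely many values on the unit circle of each coordinate plane make the matrix of tau diagonal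
    with equal entries. *)
Lemma tau_radial T : sym4 T -> eik T -> large_poles T -> large_poles (oppT T) ->
  exists a, forall x, tau T x x = a * dot x x.
Proof.
move=> hT hE hl hl'; have [i0|i1] := pickP (fun _ : 'I_n => true); last first.
  by exists 0 => x; rewrite /tau /mxtrace /dot !big_pred0 ?mulr0.
move=> _; pose d i : V := delta_mx 0 i; exists (tau T (d i0) (d i0)).
have ortho i j : i != j -> tau T (d i) (d i) = tau T (d j) (d j) /\ tau T (d i) (d j) = 0.
  move=> ij; have dij : dot (d i) (d j) = 0.
    by rewrite dot_delta mxE eqxx eq_sym (negPf ij).
  have d1 k : dot (d k) (d k) = 1 by rewrite dot_delta mxE !eqxx.
  have [c s cs|_ _ h1 h2] := @finite_on_circle R 0 0 0 (3 * tau T (d i) (d i))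
    (6 * tau T (d i) (d j)) (3 * tau T (d j) (d j)) pole_values; last by split; lra.
  have h : 3 * tau T (c *: d i + s *: d j) (c *: d i + s *: d j) \in pole_values.
    by apply: tau_unit => //; rewrite !dotE (dotC (d j)) dij !d1 -[RHS]cs; ring.
  apply: (eq_ind _ (fun t => t \in pole_values) h); rewrite !(tauE hT) (tauC hT (d j)); ring.
set a := tau T (d i0) (d i0).
have dd i j : tau T (d i) (d j) = a * (i == j)%:R.
  have [<-|ij] := eqVneq i j; last by rewrite (ortho i j ij).2 mulr0.
  by have [->|/ortho[-> _]] := eqVneq i i0; rewrite mulr1.
have cE x : contraction T x = a *: x.
  apply/rowP => k; rewrite -dot_delta dotC -tau_contraction // tauC // mxE.
  have -> : a * x 0 k = dot x (a *: d k) by rewrite dotZr dot_delta.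
  rewrite tau_contraction //; congr (dot _ _); apply/rowP => j.
  by rewrite -dot_delta dotC -tau_contraction // dd !mxE eqxx.
by move=> x; rewrite tau_contraction // cE dotZr.
Qed.

Lemma normal_exists T e : sym4 T -> eik T -> large_poles T -> pole T e ->
  exists v, normal T e v.
Proof.
move=> hT hE hl he; have PP := pole_proj_idem hT hE he.
have [|v [v1 vP]] := sym_idem_unit PP.
  by rewrite (idem_trace PP) pnatr_eq0 -lt0n (leq_trans _ (hl _ he)).
by exists v; split=> //; apply/(pole_projP hT hE he)/eqP.
Qed.

Lemma tau_radial_int T : sym4 T -> eik T -> large_poles T -> large_poles (oppT T) ->
  exists m1 m2 : int, forall x, 3 * tau T x x = 2 * (m2 - m1)%:~R * dot x x.
Proof.
move=> hT hE hl hl'; have [a aE] := tau_radial hT hE hl hl'.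
(* With q and q' the ranks at [e] and at a midpoint, [tau_pole] gives 3b = n + 2 - 4q and -3b = n +
   2 - 4q'; subtracting yields 3b = 2(q' - q). *)
have key T' b e : sym4 T' -> eik T' -> large_poles T' -> pole T' e ->
    (forall x, tau T' x x = b * dot x x) ->
    exists m1 m2 : int, 3 * b = 2 * (m2 - m1)%:~R.
  move=> hT' hE' hl0 he bE; have [v hv] := normal_exists hT' hE' hl0 he.
  have [r [_ hm _]] := normal_midpoint hT' hE' he hv.
  have := tau_pole (oppT_sym4 hT') (oppT_eik hE') hm; have := tau_pole hT' hE' he.
  rewrite tau_opp !bE he.1 hm.1 !mulr1; set q := \rank _; set q' := \rank _.
  by move=> h h'; exists q%:Z, q'%:Z; rewrite rmorphB /= !pmulrn in h h' *; lra.
have [i0|i1] := pickP (fun _ : 'I_n => true); last first.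
  by exists 0, 0 => x; rewrite /tau /mxtrace /dot !big_pred0 ?mulr0.
move=> _; have [x x1] : exists x : V, dot x x = 1.
  by exists (delta_mx 0 i0); rewrite dot_delta mxE !eqxx.
have posT e : pole T e -> exists m1 m2 : int, forall x, 3 * tau T x x = 2 * (m2 - m1)%:~R * dot x x.
  move=> he; have [m1 [m2 mE]] := key T a e hT hE hl he aE.
  by exists m1, m2 => y; rewrite aE mulrA mE.
have [/eqP|f1] := eqVneq (dot (T x x x) x ^+ 2) 1.
  rewrite sqrf_eq1 => /orP[] /eqP f1; first by apply: (posT x).
  have hx : pole (oppT T) x by split; rewrite ?dotNl ?f1 ?opprK.
  have [|m1 [m2 mE]] := key (oppT T) (- a) x (oppT_sym4 hT) (oppT_eik hE) hl' hx.
    by move=> y; rewrite tau_opp aE mulNr.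
  exists m2, m1 => y; rewrite aE; rewrite !rmorphB /= in mE *.
  by have := congr1 (fun t => t * dot y y) mE; rewrite /=; lra.
by have [e [_ [_ [_ [he _ _ _]]]]] := pole_circle hT hE x1 f1; apply: posT he.
Qed.

End Radial.

(** * Poles with small normal spaces *)

Section Primitive.
Variables (R : rcfType) (n : nat).
Notation V := 'rV[R]_n.
Variable T : V -> V -> V -> V.
Hypotheses (hT : sym4 T) (hE : eik T).
Implicit Types (x y z w e v u : V).

Let T12 := sym4_12 hT.
Let T23 := sym4_23 hT.
Let T34 := sym4_34 hT.
Let TE := TE hT.

Definition primitive_form := exists (A : 'M[R]_n) (s : R),
  [/\ A^T = A, A *m A = 1%:M, s = 1 \/ s = -1 &
    forall x, dot (T x x x) x = s * (2 * dot (x *m A) x ^+ 2 - dot x x ^+ 2)].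

Lemma sym_isometry_involution (A : 'M[R]_n) : A^T = A ->
  (forall x, dot (x *m A) (x *m A) = dot x x) -> A *m A = 1%:M.
Proof.
move=> sA iA; apply: mx_row_eq => x; apply: dot_inj => y.
rewrite mulmx1 mulmxA dot_mulmx sA.
have := iA (x + y); rewrite mulmxDl !dotE (dotC (y *m A)) (dotC y x) !iA; lra.
Qed.

Lemma quartic_expand x y s :
  dot (T (x + s *: y) (x + s *: y) (x + s *: y)) (x + s *: y) =
  dot (T x x x) x + 4 * s * dot (T x x x) y + 6 * s ^+ 2 * dot (T x x y) y
  + 4 * s ^+ 3 * dot (T x y y) y + s ^+ 4 * dot (T y y y) y.
Proof.
rewrite !TE (T12 y x x) (T23 x y x) (T12 y x y) (T23 y y x) (T12 y x y) !dotE.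
rewrite (T34 x x y x) (T34 x y y x) (T23 x y x) (T34 y y y x) (T23 y y x) (T12 y x y).
ring.
Qed.

Section AtPole.
Variable e : V.
Hypothesis he : pole T e.
Let e1 : dot e e = 1 := he.1.
Let eT : T e e e = e := pole_fix hE he.

(** For y orthogonal to [e] in the eigenspace of 1/3, the third-order coefficient at [e] reduces to
    4 dot (T e y y) y = 0; this cubic form is then polarised. *)
Lemma third_polar u w : dot e u = 0 -> dot e w = 0 ->
  T e e u = 3^-1 *: u -> T e e w = 3^-1 *: w -> dot (T e u u) w = 0.
Proof.
move=> eu ew hu hw.
have K a : dot (T e (u + a *: w) (u + a *: w)) (u + a *: w) = 0.
  have ea : dot e (u + a *: w) = 0 by rewrite !dotE eu ew; ring.
  have hy : T e e (u + a *: w) = 3^-1 *: (u + a *: w).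
    by rewrite !TE hu hw scalerDr !scalerA mulrC.
  have [_ _] := eik_coef hT hE e (u + a *: w); rewrite eT ea hy.
  move: (u + a *: w) => y; rewrite dotZl (dotC y) (dotC e) (T34 y y y e) (T23 y y e) (T12 y e y).
  lra.
have := K 1; have := K (-1); have := K 0; have := K 2.
rewrite !TE !dotE !(T23 e w u) (T34 e u w u) (T34 e w w u) !(T23 e w u).
move=> h1 h2 h3 h4; lra.
Qed.

(** The whole complement of [e] has eigenvalue 1/3. This forces the form to be |x|^4, the case of
    the identity involution. *)
Lemma primitive_rank0 : pole_proj T e = 0 -> primitive_form.
Proof.
move=> P0; exists 1%:M, 1; split; [exact: trmx1 | by rewrite mulmx1 | by left |] => x.
rewrite mulmx1.
have S y : dot e y = 0 -> T e e y = 3^-1 *: y.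
  move=> ey; have := mul_pole_proj hT e y; rewrite P0 mulmx0 (dotC y) ey.
  move/rowP => h; apply/rowP => i; have := h i; rewrite !mxE; lra.
have [u uE] : exists u, u = x - dot x e *: e by eexists.
have eu : dot e u = 0 by rewrite uE !dotE e1 (dotC e); ring.
have -> : x = u + dot x e *: e by rewrite uE subrK.
move: (dot x e) => c.
have Teuu : T e u u = (dot u u / 3) *: e.
  have [z zE] : exists z, z = T e u u - (dot u u / 3) *: e by eexists.
  have Tee : dot (T e u u) e = dot u u / 3 by rewrite T34 T23 S // dotZl mulrC.
  have ez : dot e z = 0 by rewrite dotC zE !dotE Tee e1; ring.
  have z0 : z = 0.
    apply: dot_eq0; rewrite {1}zE !dotE ez (third_polar eu ez (S _ eu) (S _ ez)); ring.
  by apply/eqP; rewrite -subr_eq0 -zE z0.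
have [_ + _] := eik_coef hT hE u e.
rewrite quartic_expand.
rewrite (T23 u u e) (T12 u e u) (T12 u e e) (T23 e u e) (S u eu) Teuu !dotE eT e1 (dotC u e) eu.
rewrite (T34 u u u e) (T23 u u e) (T12 u e u) Teuu !dotE eu => h.
have -> : dot (T u u u) u = dot u u ^+ 2 by lra.
by field.
Qed.

(** * One-dimensional normal space *)

Section Rank1.
Variable v : V.
Hypotheses (hv : normal T e v) (Pv : pole_proj T e = v^T *m v).
Let v1 : dot v v = 1 := hv.1.
Let ev : T e e v = - v := hv.2.
Let vv : T e v v = - e := normal_evv hT hE he hv.
Let vT : T v v v = v := pole_fix hE (normal_vvv hT hE he hv).
Let ve0 : dot e v = 0 := eq_dot_normal hT hE he ev.

Definition ortho u := dot e u = 0 /\ dot v u = 0.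

Lemma orthoD u w a : ortho u -> ortho w -> ortho (u + a *: w).
Proof. by move=> [u1 u2] [w1 w2]; split; rewrite !dotE ?u1 ?u2 ?w1 ?w2; ring. Qed.

Lemma hess_ortho u : ortho u -> T e e u = 3^-1 *: u.
Proof.
move=> [eu vu]; have := mul_pole_proj hT e u; rewrite Pv mulmx_outer (dotC u v) vu.
rewrite (dotC u) eu scale0r => /rowP h; apply/rowP => i; have := h i; rewrite !mxE; lra.
Qed.

Lemma cross_ortho u : ortho u -> ortho (T e v u).
Proof.
move=> hu; have [eu vu] := hu; split; rewrite dotC T34.
  by rewrite (T23 e v e) ev dotNl vu oppr0.
by rewrite vv dotNl eu oppr0.
Qed.

Notation b u := (dot (T e v u) u).

(** The components along [e] and [v] follow from symmetry; the remainder is orthogonal to itself by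
    [third_polar]. *)
Lemma euu_ortho u : ortho u -> T e u u = (dot u u / 3) *: e + b u *: v.
Proof.
move=> hu; have [eu vu] := hu.
have [z zE] : exists z, z = T e u u - ((dot u u / 3) *: e + b u *: v) by eexists.
have Te : dot (T e u u) e = dot u u / 3.
  by rewrite T34 (T23 e u e) hess_ortho // dotZl mulrC.
have Tv : dot (T e u u) v = b u by rewrite T34 (T23 e u v).
have hz : ortho z.
  by split; rewrite zE dotC !dotE ?Te ?Tv ?e1 ?v1 ?(dotC v e) ?ve0; ring.
have [ez vz] := hz.
have z0 : z = 0.
  apply: dot_eq0; rewrite {1}zE !dotE ez vz.
  by rewrite (third_polar eu ez (hess_ortho hu) (hess_ortho hz)); ring.
by apply/eqP; rewrite -subr_eq0 -zE z0.
Qed.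

Lemma quartic_ortho u : ortho u -> dot (T u u u) u = dot u u ^+ 2 - 9 / 2 * b u ^+ 2.
Proof.
move=> hu; have [eu vu] := hu; have [_ + _] := eik_coef hT hE u e.
rewrite (T23 u u e) (T12 u e u) (T12 u e e) (T23 e u e) (hess_ortho hu) (euu_ortho hu).
rewrite !dotE e1 v1 (dotC v e) ve0 (dotC u e) eu => h; lra.
Qed.

(** Second-order coefficient of the eikonal identity at [u + v] in the direction [e], with
    [quartic_ortho] substituted. *)
Lemma vvuu_ortho u : ortho u ->
  dot (T v v u) u = 3 * dot (T e v u) (T e v u) - dot u u.
Proof.
move=> hu; have [eu vu] := hu; have [hb1 hb2] := cross_ortho hu.
have [y yE] : exists y, y = u + v by eexists.
have eyy : T e y y = (dot u u / 3 - 1) *: e + b u *: v + 2 *: T e v u.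
  rewrite yE !TE (T23 e u v) euu_ortho // vv.
  by apply/rowP => i; rewrite !mxE; ring.
have eey : T e e y = 3^-1 *: u - v by rewrite yE !TE ev hess_ortho.
have [_ + _] := eik_coef hT hE y e.
rewrite (T23 y y e) (T12 y e y) (T12 y e e) (T23 e y e) eyy eey.
have -> : dot (T y y y) (3^-1 *: u - v) =
    3^-1 * dot (T u u u) u - 2 * dot (T v v u) u - 1.
  rewrite yE !TE (T23 u u v) (T12 u v u) (T12 u v v) (T23 v u v) vT !dotE.
  rewrite (T34 u u u v) (T34 v u u v) (T34 v v u v) (T23 u u v) (T12 u v u) (T23 v u v) vT.
  by rewrite v1 vu; field.
rewrite (quartic_ortho hu) yE !dotE e1 v1 vu (dotC u v) vu (dotC u e) eu (dotC v e) ve0.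
rewrite !(dotC (T e v u)) hb1 hb2 => h.
have : 3 * (dot u u / 3 - 1) ^+ 2 + 3 * b u ^+ 2 + 12 * dot (T e v u) (T e v u)
  + 2 * (3^-1 * (dot u u ^+ 2 - 9 / 2 * b u ^+ 2) - 2 * dot (T v v u) u - 1)
  = (dot u u + 1) ^+ 2 by lra.
lra.
Qed.

(** Differentiating [quartic_ortho] gives the gradient inside the complement; the [e]-component
    vanishes by [euu_ortho], and the [v]-component stays unknown for now. *)
Lemma uuu_ortho u : ortho u -> T u u u =
  dot (T v u u) u *: v + dot u u *: u - (9 / 2 * b u) *: T e v u.
Proof.
move=> hu; have [eu vu] := hu; have hc := cross_ortho hu; have [ec vc] := hc.
have grad w : ortho w ->
    dot (T u u u) w = dot u u * dot u w - 9 / 2 * b u * dot (T e v u) w.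
  move=> hw; have [|_ h _ _] := @poly6_coef R (dot (T u u u) u) (4 * dot (T u u u) w)
    (6 * dot (T u u w) w) (4 * dot (T u w w) w) (dot (T w w w) w) 0 0
    (dot u u ^+ 2 - 9 / 2 * b u ^+ 2)
    (4 * dot u u * dot u w - 18 * b u * dot (T e v u) w)
    (2 * dot u u * dot w w + 4 * dot u w ^+ 2
      - 9 / 2 * (2 * b u * b w + 4 * dot (T e v u) w ^+ 2))
    (4 * dot u w * dot w w - 18 * b w * dot (T e v u) w)
    (dot w w ^+ 2 - 9 / 2 * b w ^+ 2) 0 0; last by lra.
  move=> s; have := quartic_ortho (orthoD s hu hw).
  rewrite quartic_expand !TE !dotE (dotC w u) (T34 e v w u) => h; lra.
have [z zE] : exists z, z = T u u u -
    (dot (T v u u) u *: v + dot u u *: u - (9 / 2 * b u) *: T e v u) by eexists.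
have Te : dot (T u u u) e = 0.
  rewrite (T34 u u u e) (T23 u u e) (T12 u e u) euu_ortho // !dotE eu vu; ring.
have Tv : dot (T u u u) v = dot (T v u u) u.
  by rewrite (T34 u u u v) (T23 u u v) (T12 u v u).
have hz : ortho z.
  split; rewrite zE dotC !dotE ?Te ?Tv ?v1.
    by rewrite (dotC v e) (dotC u e) (dotC _ e) ve0 eu ec; ring.
  by rewrite (dotC u v) (dotC _ v) vu vc; ring.
have [ez vz] := hz.
have z0 : z = 0.
  apply: dot_eq0; rewrite {1}zE !dotE vz (grad z hz); ring.
by apply/eqP; rewrite -subr_eq0 -zE z0.
Qed.

(* The coefficients of [s^0] and [s^1] in the eikonal identity along [u + s e]. *)
Lemma ortho_dichotomy u : ortho u -> dot (T v u u) u = 0 /\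
  b u ^+ 2 * (9 / 4 * dot (T e v u) (T e v u) - dot u u) = 0.
Proof.
move=> hu; have [eu vu] := hu; have [ec vc] := cross_ortho hu.
have bC : b u * dot (T v u u) u = 0.
  have [+ _ _] := eik_coef hT hE u e.
  rewrite (T23 u u e) (T12 u e u) euu_ortho // !dotE (dotC u e) eu.
  rewrite (T34 u u u e) (T23 u u e) (T12 u e u) euu_ortho // !dotE eu vu.
  rewrite (T34 u u u v) (T23 u u v) (T12 u v u) => h; lra.
have := hE u; rewrite uuu_ortho // !dotE v1 vu (dotC u v) vu vc (dotC _ v) vc.
rewrite (dotC u (T e v u)); set C := dot (T v u u) u in bC *.
set B := dot (T e v u) (T e v u); set N := dot u u; set c := b u in bC * => h.
have h2 : C ^+ 2 + 9 * (c ^+ 2 * (9 / 4 * B - N)) = 0 by lra.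
have C0 : C = 0.
  have [c0|c0] := eqVneq c 0; last by apply: (mulfI c0); rewrite bC mulr0.
  by apply/eqP; rewrite -sqrf_eq0; apply/eqP; rewrite c0 in h2; lra.
by split=> //; rewrite C0 in h2; lra.
Qed.

(** All coefficients are governed by the operator [T e v] on the complement; the term
    [dot (T v u u) u] drops out by [ortho_dichotomy]. *)
Lemma form_decomp u a c : ortho u ->
  let x := u + a *: v + c *: e in
  dot (T x x x) x = c ^+ 4 + 6 * c ^+ 2 * (dot u u / 3 - a ^+ 2) + 12 * c * a * b u
    + dot u u ^+ 2 - 9 / 2 * b u ^+ 2
    + 6 * a ^+ 2 * (3 * dot (T e v u) (T e v u) - dot u u) + a ^+ 4.
Proof.
move=> hu x; have [eu vu] := hu; have [ec vc] := cross_ortho hu.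
have [C0 _] := ortho_dichotomy hu.
have [y yE] : exists y, y = u + a *: v by eexists.
have eyy : T e y y = (dot u u / 3 - a ^+ 2) *: e + b u *: v + (2 * a) *: T e v u.
  rewrite yE !TE (T23 e u v) euu_ortho // vv.
  by apply/rowP => i; rewrite !mxE; ring.
have ey : dot e y = 0 by rewrite yE !dotE eu ve0; ring.
rewrite /x -yE quartic_expand (T34 y y y e) (T23 y y e) (T12 y e y) eyy.
rewrite (T12 y e e) (T23 e y e) (T34 e e y e) eT ey e1.
have -> : dot ((dot u u / 3 - a ^+ 2) *: e + b u *: v + (2 * a) *: T e v u) y = 3 * a * b u.
  by rewrite yE !dotE eu ve0 v1 vu (dotC _ v) vc; ring.
have -> : dot ((dot u u / 3 - a ^+ 2) *: e + b u *: v + (2 * a) *: T e v u) e =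
    dot u u / 3 - a ^+ 2.
  by rewrite !dotE e1 (dotC v e) ve0 (dotC _ e) ec; ring.
have Tuv : dot (T u u u) v = 0 by rewrite (T34 u u u v) (T23 u u v) (T12 u v u).
have Tvv : dot (T u v v) v = 0 by rewrite (T12 u v v) (T23 v u v) (T34 v v u v) vT.
rewrite yE quartic_expand (quartic_ortho hu) Tuv Tvv vT v1.
rewrite (T23 u u v) (T12 u v u) (T34 v u u v) (T23 v u v) (vvuu_ortho hu).
by ring.
Qed.

Lemma decomp x : exists u a c, ortho u /\ x = u + a *: v + c *: e.
Proof.
exists (x - dot x v *: v - dot x e *: e), (dot x v), (dot x e); split; last first.
  by rewrite addrAC subrK subrK.
split; first by rewrite !dotE ve0 e1 (dotC x e); ring.
by rewrite !dotE v1 (dotC v e) ve0 (dotC x v); ring.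
Qed.

Lemma primitive_rank1 : primitive_form.
Proof.
have [b0|] := classic (forall u, ortho u -> b u = 0).
  (* When [b] vanishes identically, the involution is the reflection in the hyperplane orthogonal to
     [v]. *)
  pose A : 'M[R]_n := 1%:M - 2 *: (v^T *m v).
  have mulA x : x *m A = x - (2 * dot x v) *: v.
    by rewrite mulmxBr mulmx1 -scalemxAr mulmx_outer scalerA.
  have sA : A^T = A.
    by apply/matrixP => i j; rewrite !mxE !big_ord1 !mxE eq_sym (mulrC (v 0 i)).
  exists A, 1; split=> //; last 2 first.
  - by left.
  - move=> x; have [u [a [c [hu ->]]]] := decomp x; have [eu vu] := hu.
    have hc := cross_ortho hu; have [ec vc] := hc.
    (* The cross term of [b] at [u + T e v u] is twice this square. *)
    have B0 : dot (T e v u) (T e v u) = 0.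
      have := b0 _ (orthoD 1 hu hc); rewrite scale1r !TE !dotE.
      have := b0 _ hu; have := b0 _ hc => -> ->.
      rewrite (T34 e v (T e v u) u); lra.
    rewrite form_decomp // b0 // B0 mulA !dotE.
    rewrite e1 v1 ve0 (dotC v e) ve0 eu vu (dotC u e) eu (dotC u v) vu; by field.
  apply: sym_isometry_involution => // x.
  by rewrite mulA !dotE v1 (dotC v x); ring.
move=> nb; have [u0 nb0] := not_all_ex_not _ _ nb.
have [hu0 b0] := imply_to_and _ _ nb0.
(* Along [u0 + t *: u] the dichotomy is a product of two quadratics in t. As [b u0] is nonzero, the
   t^2 coefficient of the other factor, namely [q u], vanishes. *)
have iso u : ortho u -> 9 / 4 * dot (T e v u) (T e v u) = dot u u.
  move=> hu; apply/eqP; rewrite -subr_eq0; apply/eqP.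
  pose q w := 9 / 4 * dot (T e v w) (T e v w) - dot w w.
  apply: (@quadratic_mul_eq0 _ (b u0) (2 * dot (T e v u0) u) (b u) (q u0)
    (9 / 2 * dot (T e v u0) (T e v u) - 2 * dot u0 u) (q u)) => [t|]; last exact/eqP.
  have [_ /eqP] := ortho_dichotomy (orthoD t hu0 hu).
  rewrite mulf_eq0 sqrf_eq0 -mulf_eq0 => /eqP; rewrite /q !TE !dotE.
  rewrite (T34 e v u u0) (dotC u u0) (dotC (T e v u) (T e v u0)) => h.
  by rewrite -[RHS]h; field.
(* By [iso], 3/2 [T e v] is isometric on the complement. It sends [e] to -3/2 [v] and [v] to -3/2
   [e]; the second summand corrects -3/2 to -1. *)
pose A : 'M[R]_n := (3 / 2) *: fmx T e v + 2^-1 *: (e^T *m v + v^T *m e).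
have mulA x : x *m A = (3 / 2) *: T e v x + 2^-1 *: (dot x e *: v + dot x v *: e).
  by rewrite mulmxDr -!scalemxAr mulmxDr !mulmx_outer (mulmx_fmx hT).
have sA : A^T = A.
  apply/matrixP => i j; have := congr1 (fun M : 'M_n => M i j) (fmx_sym hT e v).
  by rewrite !mxE !big_ord1 !mxE => <-; ring.
have AE u a c : ortho u ->
    (u + a *: v + c *: e) *m A = (3 / 2) *: T e v u - c *: v - a *: e.
  move=> [eu vu]; rewrite mulA !TE vv (T23 e v e) ev !dotE.
  rewrite (dotC u e) (dotC u v) eu vu (dotC v e) ve0 e1 v1.
  by apply/rowP => i; rewrite !mxE; field.
exists A, (-1); split=> //; last 2 first.
- by right.
- move=> x; have [u [a [c [hu ->]]]] := decomp x; have [eu vu] := hu.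
  have [ec vc] := cross_ortho hu.
  rewrite form_decomp // AE // !dotE.
  rewrite !(dotC (T e v u) v) !(dotC (T e v u) e) ec vc.
  rewrite e1 v1 ve0 (dotC v e) ve0 eu vu (dotC u e) eu (dotC u v) vu.
  have -> : dot (T e v u) (T e v u) = 4 / 9 * dot u u by rewrite -(iso u hu); field.
  by field.
apply: sym_isometry_involution => // x; have [u [a [c [hu ->]]]] := decomp x.
have [eu vu] := hu; have [ec vc] := cross_ortho hu.
rewrite AE // !dotE !(dotC (T e v u) v) !(dotC (T e v u) e) ec vc.
rewrite e1 v1 ve0 (dotC v e) ve0 eu vu (dotC u e) eu (dotC u v) vu.
have -> : dot (T e v u) (T e v u) = 4 / 9 * dot u u by rewrite -(iso u hu); field.
by field.
Qed.

End Rank1.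

Lemma primitive_small_pole : (\rank (pole_proj T e) <= 1)%N -> primitive_form.
Proof.
have sP := pole_proj_sym hT e; have PP := pole_proj_idem hT hE he.
rewrite leq_eqVlt ltnS leqn0 mxrank_eq0 => /orP[/eqP rk|/eqP]; last first.
  exact: primitive_rank0.
have [|B [BB BP]] := @sym_idem_onb _ _ 1 _ sP PP; first by rewrite idem_trace // rk.
apply: (@primitive_rank1 B) => //; have B1 : dot B B = 1 by rewrite dot_mx11 BB mxE.
split=> //; apply/(pole_projP hT hE he).
by rewrite -BP mulmx_outer B1 scale1r.
Qed.

End AtPole.
End Primitive.

(** * Polarisation of a quartic polynomial *)

Section Polarisation.
Variables (R : realType) (n : nat).
Notation V := 'rV[R]_n.
Implicit Types (p q f : {mpoly R[n]}) (x y z w : V) (d : nat).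

Definition dird x p : {mpoly R[n]} := \sum_i x 0 i *: p^`M(i).

Definition mev x p : R := meval (fun i => x 0 i) p.

Lemma dird_lin x a y p : dird (a *: x + y) p = a *: dird x p + dird y p.
Proof.
rewrite /dird scaler_sumr -big_split; apply: eq_bigr => i _ /=.
by rewrite !mxE scalerDl scalerA.
Qed.

Lemma dird_mderiv x p i : dird x p^`M(i) = (dird x p)^`M(i).
Proof.
rewrite /dird linear_sum; apply: eq_bigr => j _ /=.
by rewrite mderivZ mderiv_comm.
Qed.

Lemma dirdC x y p : dird x (dird y p) = dird y (dird x p).
Proof.
rewrite [LHS]/dird [RHS]/dird.
under eq_bigr => i _ do rewrite -dird_mderiv /dird scaler_sumr.
rewrite exchange_big; apply: eq_bigr => j _ /=.
rewrite -dird_mderiv /dird scaler_sumr; apply: eq_bigr => i _.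
by rewrite !scalerA mulrC mderiv_comm.
Qed.

Lemma dird_delta i p : dird (delta_mx 0 i) p = p^`M(i).
Proof.
rewrite /dird (bigD1 i) //= big1 => [|j ji]; first by rewrite mxE !eqxx scale1r addr0.
by rewrite mxE (negPf ji) andbF scale0r.
Qed.

Lemma mev_dird x y p : mev x (dird y p) = \sum_i y 0 i * mev x p^`M(i).
Proof. by rewrite /mev raddf_sum; apply: eq_bigr => i _; rewrite /= mevalZ. Qed.

Lemma mpolyX_mderiv (m : 'X_{1..n}) i :
  'X_i * ('X_[m] : {mpoly R[n]})^`M(i) = (m i)%:R *: 'X_[m].
Proof.
(* If [m i] is 0, subtracting [U_(i)] truncates, but the coefficient is 0 as well. *)
rewrite mderivX -scalerAr; have [->|mi] := posnP (m i); first by rewrite !scale0r.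
by rewrite -mpolyXD addmC submK // lep1mP -lt0n.
Qed.

Lemma euler_identity d p x : p \is d.-homog -> mev x (dird x p) = d%:R * mev x p.
Proof.
move=> /dhomogP hp; rewrite mev_dird.
have dE i : mev x p^`M(i) =
    \sum_(m <- msupp p) p@_m * mev x ('X_[m] : {mpoly R[n]})^`M(i).
  rewrite {1}[p]mpolyE linear_sum /mev raddf_sum; apply: eq_bigr => m _ /=.
  by rewrite mderivZ mevalZ.
have pE : mev x p = \sum_(m <- msupp p) p@_m * mev x 'X_[m].
  rewrite {1}[p]mpolyE /mev raddf_sum; apply: eq_bigr => m _ /=.
  by rewrite mevalZ.
under eq_bigr => i _ do rewrite dE mulr_sumr.
rewrite exchange_big pE mulr_sumr /=; apply: eq_big_seq => m mp.
have := hp m mp; rewrite /= mdegE => <-.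
rewrite natr_sum mulr_suml; apply: eq_bigr => i _.
rewrite mulrCA [RHS]mulrCA; congr (_ * _).
by rewrite /mev -[RHS]mevalZ -mpolyX_mderiv mevalM mevalXU.
Qed.

Lemma mderiv_dhomog d p i : p \is d.+1.-homog -> p^`M(i) \is d.-homog.
Proof.
move=> /dhomogP hp; rewrite [p]mpolyE raddf_sum big_seq; apply: rpred_sum => m mp /=.
rewrite mderivZ mderivX; apply: rpredZ.
have [->|mi] := posnP (m i); first by rewrite scale0r rpred0.
apply: rpredZ; rewrite dhomogX /=; apply/eqP.
have := hp m mp; rewrite /= => md; apply/eqP; rewrite -eqSS -md.
by rewrite -[in X in _ == X](@submK _ U_(i) m) ?mdegD ?mdeg1 ?addn1 // lep1mP -lt0n.
Qed.

Lemma dird_dhomog d x p : p \is d.+1.-homog -> dird x p \is d.-homog.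
Proof. by move=> hp; apply: rpred_sum => i _; apply/rpredZ/mderiv_dhomog. Qed.

Lemma mev_const x y p : p \is 0.-homog -> mev x p = mev y p.
Proof.
move=> /dhomogP hp; rewrite [p]mpolyE /mev !raddf_sum big_seq [RHS]big_seq.
apply: eq_bigr => m mp; rewrite /= !mevalZ.
have /eqP := hp m mp; rewrite /= mdeg_eq0 => /eqP ->.
by rewrite mpolyX0 !meval1.
Qed.

(** Second derivatives of a quadratic form are constant, so the evaluation point may be moved from 0
    to [x], where the Euler identity applies twice. *)
Lemma mev_euler2 x p : p \is 2.-homog -> mev 0 (dird x (dird x p)) = 2 * mev x p.
Proof.
move=> hp; have h1 := dird_dhomog x hp; have h0 := dird_dhomog x h1.
by rewrite (mev_const _ x h0) (euler_identity _ h1) (euler_identity _ hp) mul1r.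
Qed.

Lemma mev_euler3 x p : p \is 3.-homog ->
  mev 0 (dird x (dird x (dird x p))) = 6 * mev x p.
Proof.
move=> hp; rewrite mev_euler2 ?dird_dhomog // (euler_identity _ hp).
ring.
Qed.

Lemma mev_euler4 x p : p \is 4.-homog ->
  mev 0 (dird x (dird x (dird x (dird x p)))) = 24 * mev x p.
Proof.
move=> hp; rewrite mev_euler3 ?dird_dhomog // (euler_identity _ hp).
ring.
Qed.

(** For a quartic the fourth derivative is constant, so evaluating at 0 loses nothing; 24 = 4! makes
    the diagonal equal to [f]. *)
Definition polar f x y z : V :=
  \row_l (24^-1 * mev 0 (dird x (dird y (dird z f)))^`M(l)).

Lemma polarE f x y z l :
  polar f x y z 0 l = 24^-1 * mev 0 (dird x (dird y (dird z f)))^`M(l).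
Proof. by rewrite mxE. Qed.

Lemma dot_polar f x y z w :
  dot (polar f x y z) w = 24^-1 * mev 0 (dird x (dird y (dird z (dird w f)))).
Proof.
rewrite (dirdC z w) (dirdC y w) (dirdC x w) mev_dird mulr_sumr; apply: eq_bigr => i _.
by rewrite polarE; ring.
Qed.

Lemma polar_sym4 f : sym4 (polar f).
Proof.
split=> [a x x' y z|x y z|x y z|x y z w].
- apply: dot_inj => w; rewrite !dotE !dot_polar dird_lin /mev mevalD mevalZ; ring.
- apply: dot_inj => w; rewrite [LHS]dot_polar [RHS]dot_polar.
  exact: (congr1 (fun q => 24^-1 * mev 0 q) (dirdC x y _)).
- apply: dot_inj => w; rewrite [LHS]dot_polar [RHS]dot_polar.
  exact: (congr1 (fun q => 24^-1 * mev 0 (dird x q)) (dirdC y z _)).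
- rewrite [LHS]dot_polar [RHS]dot_polar.
  exact: (congr1 (fun q => 24^-1 * mev 0 (dird x (dird y q))) (dirdC z w _)).
Qed.

Section Quartic.
Variable f : {mpoly R[n]}.
Hypothesis hf : f \is 4.-homog.

Lemma polar_diag x : dot (polar f x x x) x = mev x f.
Proof. by rewrite dot_polar mev_euler4 // mulrA mulVf ?mul1r // pnatr_eq0. Qed.

Lemma polar_grad x i : polar f x x x 0 i = 4^-1 * mev x f^`M(i).
Proof.
rewrite polarE -!dird_mderiv mev_euler3 ?mderiv_dhomog // mulrA; congr (_ * _).
by field.
Qed.

Lemma polar_laplacian x : mev x (laplacian f) = 12 * tau (polar f) x x.
Proof.
rewrite /tau /mxtrace mulr_sumr /laplacian /mev raddf_sum; apply: eq_bigr => i _ /=.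
rewrite mxE polarE dird_delta -!dird_mderiv mev_euler2 ?mderiv_dhomog // /mev.
by field.
Qed.

Lemma polar_eik : (forall x : 'I_n -> R, grad_sq f x = 16 * enorm x ^+ 6) -> eik (polar f).
Proof.
move=> h x; have := h (fun i => x 0 i); rewrite /grad_sq /enorm.
have -> : sqnorm (fun i => x 0 i) = dot x x by apply: eq_bigr => i _; rewrite expr2.
rewrite (exprM _ 2 3) sqr_sqrtr ?dot_ge0 // => e.
have -> : dot (polar f x x x) (polar f x x x) =
    16^-1 * \sum_i (f^`M(i)).@[fun i => x 0 i] ^+ 2.
  by rewrite mulr_sumr; apply: eq_bigr => i _; rewrite !polar_grad /mev; field.
by rewrite e; field.
Qed.

End Quartic.
End Polarisation.

(** * Translation back to polynomials and the final case distinction *)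

Lemma mev_row (R : realType) n (x : 'I_n -> R) p : mev (\row_i x i) p = meval x p.
Proof. by apply: meval_eq => i; rewrite mxE. Qed.

Lemma dot_row (R : realType) n (x : 'I_n -> R) :
  dot (\row_i x i) (\row_i x i) = enorm x ^+ 2.
Proof.
rewrite sqr_sqrtr; last by apply: sumr_ge0 => i _; rewrite sqr_ge0.
by apply: eq_bigr => i _; rewrite !mxE expr2.
Qed.

Theorem theorem1p3 (R : realType) (n : nat) (f : {mpoly R[n]}) :
  f \is 4.-homog ->
  (forall x : 'I_n -> R, grad_sq f x = 16 * enorm x ^+ 6) ->
  isoparametric 4 f \/
  exists k : nat, (k <= n./2)%N /\ congruent (prim_quartic R n k) f.
Proof.
move=> hf hgrad; pose T := polar f.
have hT : sym4 T := polar_sym4 f; have hE : eik T := polar_eik hf hgrad.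
(* Serves both [T] and [oppT T]; the sign [c] is absorbed into the sign of the primitive form. *)
have prim T' c : c = 1 \/ c = -1 -> primitive_form T' ->
    (forall x, dot (T' x x x) x = c * mev x f) ->
    exists k : nat, (k <= n./2)%N /\ congruent (prim_quartic R n k) f.
  move=> hc [A [s [sA AA hs fE]]] hT'.
  apply: (@involution_congruent _ _ f A (c * s)) => // [|x X].
    by case: hc => ->; case: hs => ->; [left | right | right | left]; ring.
  have := fE X; rewrite hT' mev_row -mulrA => <-.
  by case: hc => ->; ring.
have small T' : sym4 T' -> eik T' -> ~ large_poles T' -> primitive_form T'.
  move=> hT' hE' hl; have [e ne] := not_all_ex_not _ _ hl.
  have [he rk] := imply_to_and _ _ ne.
  by apply: (primitive_small_pole hT' hE' he); rewrite leqNgt; apply/negP.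
have [hl|hl] := classic (large_poles T); last first.
  right; apply: (prim T 1); [by left | exact: small |] => x.
  by rewrite mul1r polar_diag.
have [hl'|hl'] := classic (large_poles (oppT T)); last first.
  right; apply: (prim (oppT T) (-1)); first by right.
    exact: small (oppT_sym4 hT) (oppT_eik hE) hl'.
  by move=> x; rewrite dotNl polar_diag // mulN1r.
left; have [m1 [m2 mE]] := tau_radial_int hT hE hl hl'.
split; first by split=> // x; exact: hgrad.
exists m1, m2 => x; have := mE (\row_i x i).
(* The Laplacian is 12 tau = 8 (m2 - m1)|x|^2, and 8 is 16/2. *)
rewrite -mev_row polar_laplacian // dot_row => h.
have -> : (4 ^ 2)%:R = 16 :> R by [].
have -> : (4 - 2)%N = 2%N by [].
by lra.
Qed.
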